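(* Let $A\in\mathbb{R}^{n\times n}$ be symmetric positive definite with eigenvalues $0<\lambda_1<\lambda_2\le\dots\le\lambda_n$ and let $u_*$ be an eigenvector of $A$ associated with $\lambda_1$. Let $\widehat L$ be the Cholesky factor of $A$ computed in a lower precision with unit roundoff $\mathbf u_l$, and let the preconditioner $B$ be defined by $B^{-1}x:=\widehat L^{-\mathsf T}(\widehat L^{-1}x)$. Assume that $$\epsilon_l:=4n(3n+1)\frac{\lambda_n}{\lambda_1}\mathbf u_l<1.$$ Then $$\|I-A^{1/2}B^{-1}A^{1/2}\|\le\frac{\epsilon_l}{1-\epsilon_l},$$ and the angle of distortion $\varphi$ satisfies $\cos^2\varphi\le 2\epsilon_l$, that is, $\cos\varphi\le\sqrt{2\epsilon_l}$.
   Context: Two levels of floating-point precision are considered: a working precision and a lower precision (for example, IEEE double and single precision). The preconditioner is constructed in lower precision: the exact Cholesky factorization is $A=LL^{\mathsf T}$, $\widehat L$ is the factor computed in lower precision, and $B^{-1}x$ is implemented by solving two triangular linear systems by forward and backward substitution in lower precision. All other computations are carried out in working precision, and the effects of round-off errors in working precision are ignored. $\|\cdot\|$ is the Euclidean norm of vectors and the spectral norm of matrices, and $\|v\|_C:=\sqrt{v^{\mathsf T}Cv}$ for a symmetric positive definite matrix $C$. The angle of distortion is $\varphi:=\arcsin\dfrac{\|u_*\|^2}{\|u_*\|_B\|u_*\|_{B^{-1}}}\in(0,\pi/2]$. *)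

(* Defs.v *)
From HB Require Import structures.
From mathcomp Require Import all_boot all_order all_algebra.
From mathcomp Require Import all_classical all_reals all_analysis.

Set Implicit Arguments.
Unset Strict Implicit.
Unset Printing Implicit Defensive.

Import Order.TTheory GRing.Theory Num.Theory.

Local Open Scope classical_set_scope.
Local Open Scope ring_scope.

Definition posdefmx (R : realType) (n : nat) (C : 'M[R]_n) : Prop :=
  C^T = C /\ forall x : 'cV[R]_n, x != 0 -> 0 < (x^T *m C *m x) ord0 ord0.

(* [lam] lists the eigenvalues of [A] in nondecreasing order, repeated
   according to (algebraic) multiplicity. *)
Definition sorted_eigenvalues (R : realType) (n : nat) (A : 'M[R]_n)
    (lam : n.-tuple R) : Prop :=
  char_poly A = \prod_(l <- lam) ('X - l%:P) /\ sorted <=%R lam.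

(* S = A^(1/2) *)
Definition is_sqrtmx (R : realType) (n : nat) (A S : 'M[R]_n) : Prop :=
  posdefmx S /\ S *m S = A.

(* The library norm on matrices is the max norm, so the Euclidean and the
   spectral norm are introduced here. *)
Definition enorm (R : realType) (n : nat) (v : 'cV[R]_n) : R :=
  Num.sqrt (\sum_i v i ord0 ^+ 2).

Definition spectral_norm (R : realType) (n : nat) (M : 'M[R]_n) : R :=
  sup [set enorm (M *m x) | x in [set x : 'cV[R]_n | enorm x <= 1]].

Definition norm_wrt (R : realType) (n : nat) (C : 'M[R]_n) (v : 'cV[R]_n) : R :=
  Num.sqrt ((v^T *m C *m v) ord0 ord0).

(* Standard model of floating-point arithmetic with unit roundoff [ul] (no
   overflow or underflow): [y] is an admissible computed result of an operation
   whose exact result is [x].  Being a relation, it covers every rounding rule,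
   and the error-free case. *)
Definition rounded (R : realType) (ul x y : R) : Prop :=
  exists2 delta : R, `|delta| <= ul & y = x * (1 + delta).

(* [y] is an admissible computed value of the sum of the terms [s], the
   additions being performed in an arbitrary order and with an arbitrary
   bracketing, each of them subject to rounding. *)
Inductive rounded_sum (R : realType) (ul : R) : seq R -> R -> Prop :=
| RoundedSum1 (x : R) : rounded_sum ul [:: x] x
| RoundedSumD (s s1 s2 : seq R) (y1 y2 y : R) :
    perm_eq s (s1 ++ s2) -> rounded_sum ul s1 y1 -> rounded_sum ul s2 y2 ->
    rounded ul (y1 + y2) y -> rounded_sum ul s y.

(* [L] is a lower triangular factor returned by the Cholesky algorithm
     l_jj = sqrt (a_jj - \sum_(k < j) l_jk ^ 2),
     l_ij = (a_ij - \sum_(k < j) l_ik l_jk) / l_jj   (j < i)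
   run on [A] in floating-point arithmetic with unit roundoff [ul].  [Al] is
   [A] rounded to that precision ([Al = A] is allowed), [p k] are the computed
   products and [s] is the computed difference.
   Successful completion is not part of the definition: on a nonpositive [s] the
   square root is 0 by convention, so that excluding a breakdown is left to
   theorems about [computed_cholesky]. *)
Definition computed_cholesky (R : realType) (n : nat) (ul : R)
    (A L : 'M[R]_n) : Prop :=
  (forall i j : 'I_n, (i < j)%N -> L i j = 0) /\
  exists2 Al : 'M[R]_n,
    (forall i j : 'I_n, rounded ul (A i j) (Al i j)) &
    forall i j : 'I_n, (j <= i)%N ->
      exists (p : 'I_n -> R) (s : R),
        [/\ forall k : 'I_n, (k < j)%N -> rounded ul (L i k * L j k) (p k),
            rounded_sum ul (Al i j :: [seq - p k | k : 'I_n <- enum 'I_n & (k < j)%N]) s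
          & rounded ul (if i == j then Num.sqrt s else s / L j j) (L i j)].

(* The matrix of x |-> L^-T (L^-1 x), and the preconditioner B it inverts. *)
Definition precond_inv (R : realType) (n : nat) (L : 'M[R]_n) : 'M[R]_n :=
  invmx L^T *m invmx L.

Definition precond (R : realType) (n : nat) (L : 'M[R]_n) : 'M[R]_n :=
  invmx (precond_inv L).

Definition distortion_angle (R : realType) (n : nat) (B : 'M[R]_n)
    (u : 'cV[R]_n) : R :=
  asin (enorm u ^+ 2 / (norm_wrt B u * norm_wrt (invmx B) u)).

(* Main.v *)
Require Import Defs.
From HB Require Import structures.
From mathcomp Require Import all_boot all_order all_algebra.
From mathcomp Require Import spectral complex ring lra.
From mathcomp Require Import all_classical all_reals all_analysis.

Set Implicit Arguments.
Unset Strict Implicit.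
Unset Printing Implicit Defensive.

Import Order.TTheory GRing.Theory Num.Theory.

Local Open Scope ring_scope.

(** Each computed entry satisfies a_ij = \sum_k l_ik l_jk up to an error
    g (|a_ij| + \sum_k |l_ik l_jk|) with g of order n u, whatever the summation
    order.  If j is the first index with l_jj = 0, the leading rows of L have a
    nonzero left kernel vector x, and x^T A x only sees the rounding errors; these
    are too small for x^T A x >= lambda_1 |x|^2, so no breakdown occurs.  The
    squared row norms of L are then at most (4/3) lambda_n, which gives
    |L L^T - A| <= epsilon_l lambda_1.  With F = A^(-1/2) (B - A) A^(-1/2), of norm
    at most epsilon_l, and M = A^(1/2) B^-1 A^(1/2), the vector y = (I - M) x solves
    y + F y = F x, which gives the first bound.  Finally |u|_B^2 and |u|_{B^-1}^2
    are at most (1 + epsilon_l) lambda_1 |u|^2 and |u|^2 / ((1 - epsilon_l) lambda_1),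
    so that sin^2 phi >= (1 - epsilon_l) / (1 + epsilon_l). *)

(** * Euclidean norm *)

Section EuclideanNorm.
Variable R : realType.

Lemma enorm_ge0 n (v : 'cV[R]_n) : 0 <= enorm v.
Proof. exact: sqrtr_ge0. Qed.

Lemma enorm_sqr n (v : 'cV[R]_n) : enorm v ^+ 2 = \sum_i v i ord0 ^+ 2.
Proof. by rewrite sqr_sqrtr // sumr_ge0 // => i _; rewrite sqr_ge0. Qed.

Lemma enorm_sqrE n (v : 'cV[R]_n) : enorm v ^+ 2 = (v^T *m v) ord0 ord0.
Proof. by rewrite enorm_sqr mxE; apply: eq_bigr => i _; rewrite mxE expr2. Qed.

Lemma enorm_gt0 n (v : 'cV[R]_n) : (0 < enorm v) = (v != 0).
Proof.
rewrite lt0r enorm_ge0 andbT; congr (~~ _).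
apply/eqP/eqP => [v0|->]; last first.
  by apply/eqP; rewrite -sqrf_eq0 enorm_sqr big1 // => i _; rewrite mxE expr0n.
apply/matrixP => i j; rewrite (ord1 j) mxE; apply/eqP; rewrite -sqrf_eq0.
have /eqP : \sum_i v i ord0 ^+ 2 = 0 by rewrite -enorm_sqr v0 expr0n.
by rewrite psumr_eq0 => [/allP/(_ i (mem_index_enum _))|*]; rewrite ?sqr_ge0.
Qed.

Lemma cauchy_schwarz_sum (I : finType) (a b : I -> R) :
  (\sum_i a i * b i) ^+ 2 <= (\sum_i a i ^+ 2) * (\sum_i b i ^+ 2).
Proof.
set p := \sum_i _; set q := \sum_i _; set r := \sum_i _.
have q_ge0 : 0 <= q by apply: sumr_ge0 => i _; rewrite sqr_ge0.
have expand t : \sum_i (t * a i - b i) ^+ 2 = t ^+ 2 * q - 2 * t * p + r.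
  rewrite !mulr_sumr -sumrB -big_split /=.
  by apply: eq_bigr => i _; ring.
have pos t : 0 <= t ^+ 2 * q - 2 * t * p + r.
  by rewrite -expand sumr_ge0 // => i _; rewrite sqr_ge0.
have [q0|q_neq0] := eqVneq q 0; last first.
  have q_gt0 : 0 < q by rewrite lt0r q_neq0.
  have /(mulr_ge0 q_ge0) := pos (p / q).
  have -> : q * ((p / q) ^+ 2 * q - 2 * (p / q) * p + r) = q * r - p ^+ 2.
    by field.
  by rewrite subr_ge0.
have a0 i : a i = 0.
  apply/eqP; rewrite -sqrf_eq0; move/eqP: q0.
  by rewrite psumr_eq0 => [/allP/(_ i (mem_index_enum _))|*]; rewrite ?sqr_ge0.
by rewrite q0 mul0r /p big1 ?expr0n // => i _; rewrite a0 mul0r.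
Qed.

Lemma dot_le_enorm n (v w : 'cV[R]_n) :
  `|(v^T *m w) ord0 ord0| <= enorm v * enorm w.
Proof.
rewrite -ler_sqr ?nnegrE ?mulr_ge0 ?enorm_ge0 //.
rewrite exprMn !enorm_sqr real_normK ?num_real // mxE.
under eq_bigr do rewrite mxE.
exact: cauchy_schwarz_sum.
Qed.

Lemma enormD n (v w : 'cV[R]_n) : enorm (v + w) <= enorm v + enorm w.
Proof.
rewrite -ler_sqr ?nnegrE ?addr_ge0 ?enorm_ge0 //.
have -> : enorm (v + w) ^+ 2 =
    enorm v ^+ 2 + 2 * (v^T *m w) ord0 ord0 + enorm w ^+ 2.
  rewrite !enorm_sqr mxE mulr_sumr -!big_split /=.
  by apply: eq_bigr => i _; rewrite !mxE; ring.
have /ler_normlP[_ vw] := dot_le_enorm v w.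
by rewrite sqrrD -mulr_natl; nra.
Qed.

Lemma enormN n (v : 'cV[R]_n) : enorm (- v) = enorm v.
Proof. by congr Num.sqrt; apply: eq_bigr => i _; rewrite mxE sqrrN. Qed.

End EuclideanNorm.

(** * Extreme eigenvalues of a symmetric matrix *)

Section Rayleigh.
Variables (R : realType) (n : nat) (A : 'M[R]_n) (lam : n.-tuple R).
Hypotheses (A_sym : A^T = A) (lamP : sorted_eigenvalues A lam).
Local Notation toC := (real_complex R).
Local Notation P := (spectralmx (map_mx toC A)).
Local Notation D := (spectral_diag (map_mx toC A)).

(** Over [R[i]] a real symmetric matrix is Hermitian, hence normal and unitarily diagonalizable. *)
Local Lemma complexified_spectral :
  map_mx toC A = map_mx Num.conj P^T *m diag_mx D *m P.
Proof.
rewrite -invmx_unitary ?spectral_unitarymx //.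
apply/orthomx_spectralP/hermitian_normalmx/realsym_hermsym.
  by apply/is_hermitianmxP; rewrite expr0 scale1r map_mx_id // map_trmx A_sym.
by apply/mxOverP => i j; rewrite mxE; apply/complex_realP; exists (A i j).
Qed.

(** Each row of [P] is a left eigenvector, so each entry of [D] is a root of the characteristic
    polynomial, which splits over [lam]. *)
Local Lemma spectral_diag_eigenvalue i : exists2 l, l \in lam & D ord0 i = toC l.
Proof.
have P_unit := spectral_unit (map_mx toC A).
have rowE : row i P *m map_mx toC A = D ord0 i *: row i P.
  have := complexified_spectral; rewrite -invmx_unitary ?spectral_unitarymx //.
  move: P D P_unit => p d p_unit ->.
  rewrite -row_mul !mulmxA mulmxV // mul1mx row_mul row_diag_mx.
  by rewrite -scalemxAl -rowE.
have row_neq0 : row i P != 0.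
  apply/eqP => /(congr1 (mulmx^~ (invmx P))).
  rewrite -row_mul mulmxV // mul0mx => /matrixP/(_ ord0 i).
  by rewrite !mxE eqxx => /eqP; rewrite oner_eq0.
have : eigenvalue (map_mx toC A) (D ord0 i) by apply/eigenvalueP; exists (row i P).
rewrite eigenvalue_root_char -map_char_poly lamP.1 rmorph_prod /=.
rewrite (eq_bigr (fun l => 'X - (toC l)%:P)) => [|l _]; last first.
  by rewrite rmorphB /= map_polyX map_polyC.
by rewrite -(big_map toC predT (fun z => 'X - z%:P)) root_prod_XsubC
  => /mapP[l lam_l ->]; exists l.
Qed.

(** The diagonal [d] is left free: [D] gives the form of [A], and the constant 1 gives
    [enorm x ^+ 2]. *)
Local Lemma complexified_form (M : 'M[R]_n) (d : 'rV[R[i]]_n) (x : 'cV[R]_n) :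
  map_mx toC M = map_mx Num.conj P^T *m diag_mx d *m P ->
  toC ((x^T *m M *m x) ord0 ord0) =
    \sum_i d ord0 i * `|(P *m map_mx toC x) i ord0| ^+ 2.
Proof.
move=> ME; have -> : toC ((x^T *m M *m x) ord0 ord0) =
    (map_mx toC (x^T *m M *m x)) ord0 ord0 by rewrite [RHS]mxE.
rewrite !map_mxM /= ME; set y := P *m map_mx toC x.
have -> : map_mx toC x^T *m (map_mx Num.conj P^T *m diag_mx d *m P)
    *m map_mx toC x = map_mx Num.conj y^T *m diag_mx d *m y.
  rewrite /y trmx_mul map_mxM /= !mulmxA.
  suff <- : map_mx toC x^T = map_mx Num.conj (map_mx toC x)^T by [].
  apply/matrixP => i j; rewrite !mxE; apply/esym/CrealP.
  by apply/complex_realP; exists (x j i).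
rewrite mxE; apply: eq_bigr => i _; rewrite mul_mx_diag !mxE normCK.
by ring.
Qed.

Lemma rayleigh_bounds (x : 'cV[R]_n) :
  lam`_0 * enorm x ^+ 2 <= (x^T *m A *m x) ord0 ord0 <=
    lam`_n.-1 * enorm x ^+ 2.
Proof.
have sumE : toC (enorm x ^+ 2) = \sum_i `|(P *m map_mx toC x) i ord0| ^+ 2.
  rewrite enorm_sqrE -[x^T]mulmx1 (@complexified_form _ (const_mx 1)).
    by apply: eq_bigr => i _; rewrite mxE mul1r.
  rewrite map_mx1 -invmx_unitary ?spectral_unitarymx //.
  by rewrite diag_const_mx mulmx1 mulVmx ?spectral_unit.
have lamD i : toC lam`_0 <= D ord0 i <= toC lam`_n.-1.
  have [l lam_l ->] := spectral_diag_eigenvalue i.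
  have [k k_lt <-] := nthP 0 lam_l; rewrite size_tuple in k_lt.
  have n_gt0 : (0 < n)%N by apply: leq_ltn_trans k_lt.
  have le_nth := sorted_leq_nth le_trans lexx 0 lamP.2.
  by rewrite !lecR !le_nth ?inE ?size_tuple ?prednK // -ltnS prednK.
have scaleE c : toC (c * enorm x ^+ 2) =
    toC c * \sum_i `|(P *m map_mx toC x) i ord0| ^+ 2.
  by rewrite -sumE; apply: rmorphM.
apply/andP; split; rewrite -lecR scaleE;
  rewrite (complexified_form x complexified_spectral) mulr_sumr;
  apply: ler_sum => i _; apply: ler_wpM2r; rewrite ?exprn_ge0 //;
  by case/andP: (lamD i).
Qed.

End Rayleigh.

(** * Rounding errors in the Cholesky algorithm *)

(** Induction on the bracketing; in any order, the number of additions is one less than the number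
    of terms, hence the exponent. *)
Lemma rounded_sum_error (R : realType) (u : R) (s : seq R) (y : R) :
  0 <= u -> rounded_sum u s y ->
  (0 < size s)%N /\
  `|y - \sum_(x <- s) x| <= ((1 + u) ^+ (size s).-1 - 1) * \sum_(x <- s) `|x|.
Proof.
move=> u_ge0; elim=> {s y} [x|s s1 s2 y1 y2 y s12 _ [s1_gt0 IH1] _ [s2_gt0 IH2]].
  by rewrite !big_seq1 /= expr0 !subrr normr0 mul0r.
case=> d d_le ->; rewrite (perm_size s12) size_cat addn_gt0 s1_gt0; split=> //.
rewrite !(perm_big _ s12) /= !big_cat /=.
set S1 := \sum_(x <- s1) x in IH1 *; set S2 := \sum_(x <- s2) x in IH2 *.
set T1 := \sum_(x <- s1) _ in IH1 *; set T2 := \sum_(x <- s2) _ in IH2 *.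
have [T1_ge S1T1] : 0 <= T1 /\ `|S1| <= T1.
  by rewrite sumr_ge0 // ler_norm_sum.
have [T2_ge S2T2] : 0 <= T2 /\ `|S2| <= T2.
  by rewrite sumr_ge0 // ler_norm_sum.
(* Both partial sums have at least one term, so their exponents are at most this one; the factor
   [1 + u] left over pays for the final addition. *)
pose q := (1 + u) ^+ (size s1 + size s2).-2.
have u1 : 1 <= 1 + u by rewrite lerDl.
have -> : (1 + u) ^+ (size s1 + size s2).-1 = (1 + u) * q.
  by rewrite -exprS; congr (_ ^+ _); case: (size s1) s1_gt0 => [|a] // _;
     case: (size s2) s2_gt0 => [|b] // _; rewrite addnS.
have q_ge1 : 1 <= q by apply: exprn_ege1.
have {}IH1 : `|y1 - S1| <= (q - 1) * T1.
  apply: le_trans IH1 _; apply: ler_wpM2r => //; rewrite lerD2r.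
  apply: ler_weXn2l => //; move: s1_gt0 s2_gt0.
  by case: (size s1) (size s2) => [|a] [|b] //= _ _; rewrite addnS /= leq_addr.
have {}IH2 : `|y2 - S2| <= (q - 1) * T2.
  apply: le_trans IH2 _; apply: ler_wpM2r => //; rewrite lerD2r.
  apply: ler_weXn2l => //; move: s1_gt0 s2_gt0.
  by case: (size s1) (size s2) => [|a] [|b] //= _ _; rewrite addnS /= leq_addl.
have -> : (y1 + y2) * (1 + d) - (S1 + S2) =
    (1 + d) * (y1 - S1) + (1 + d) * (y2 - S2) + d * (S1 + S2) by ring.
have d1 : `|1 + d| <= 1 + u.
  by apply: le_trans (ler_normD _ _) _; rewrite normr1 lerD2l.
have -> : ((1 + u) * q - 1) * (T1 + T2) = (1 + u) * ((q - 1) * T1)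
    + (1 + u) * ((q - 1) * T2) + u * (T1 + T2) by ring.
apply: le_trans (ler_normD _ _) _; apply: lerD.
  by apply: le_trans (ler_normD _ _) _; rewrite !normrM lerD // ler_pM.
rewrite normrM ler_pM //; apply: le_trans (ler_normD _ _) _; exact: lerD.
Qed.

Section CholeskyRounding.
Variables (R : realType) (n : nat) (A L : 'M[R]_n) (u g : R).
Hypotheses (u_ge0 : 0 <= u) (u_lt1 : u < 1).
Hypothesis (prod_le : (1 + u) ^+ n - 1 <= g).
Hypothesis (quot_le : 1 <= (1 + g) * (1 - u) ^+ 2).
Hypothesis (L_chol : computed_cholesky u A L).

Lemma computed_cholesky_g_ge0 : 0 <= g.
Proof. by apply: le_trans prod_le; rewrite subr_ge0 exprn_ege1 // lerDl. Qed.

(** Each term passes through at most [c] additions, [c] being the number of products, after one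
    rounding of its own. As [j] is not among the indices below [j], [c + 1 <= n] and [prod_le]
    applies. *)
Lemma computed_difference_error (i j : 'I_n) (a s : R) (p : 'I_n -> R) :
  rounded u (A i j) a ->
  (forall k : 'I_n, (k < j)%N -> rounded u (L i k * L j k) (p k)) ->
  rounded_sum u (a :: [seq - p k | k : 'I_n <- enum 'I_n & (k < j)%N]) s ->
  `|s - (A i j - \sum_(k < n | (k < j)%N) L i k * L j k)| <=
    g * (`|A i j| + \sum_(k < n | (k < j)%N) `|L i k * L j k|).
Proof.
case=> d d_le ->{a} p_round /(rounded_sum_error u_ge0)[_].
rewrite !big_cons !big_map !big_filter !big_enum_cond /= size_map size_filter.
set c := count _ _; set S := \sum_(k < n | _) L i k * _.
set T := \sum_(k < n | _) `|L i k * _|.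
have c_lt : (c.+1 <= n)%N.
  rewrite -[n in leqRHS](size_enum_ord n) -(count_predC (fun k : 'I_n => (k < j)%N)).
  rewrite -[c.+1]addn1 leq_add2l -has_count.
  by apply/hasP; exists j; rewrite ?mem_enum //= ltnn.
have u1 : 1 <= 1 + u by rewrite lerDl.
have d1 (x : R) : `|x| <= u -> `|1 + x| <= 1 + u.
  by move=> x_le; apply: le_trans (ler_normD _ _) _; rewrite normr1 lerD2l.
have T_ge0 : 0 <= T by apply: sumr_ge0.
have p_sum : `|\sum_(k < n | (k < j)%N) - p k + S| <= u * T.
  rewrite -big_split /= mulr_sumr; apply: le_trans (ler_norm_sum _ _ _) _.
  apply: ler_sum => k kj; have [e e_le ->] := p_round k kj.
  have -> : - (L i k * L j k * (1 + e)) + L i k * L j k = - (e * (L i k * L j k)).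
    by ring.
  by rewrite normrN normrM ler_wpM2r.
have p_norm : \sum_(k < n | (k < j)%N) `|- p k| <= (1 + u) * T.
  rewrite mulr_sumr; apply: ler_sum => k kj; have [e e_le ->] := p_round k kj.
  by rewrite normrN [_ * (1 + e)]mulrC normrM ler_wpM2r // d1.
set P := \sum_(k < n | _) - p k in p_sum *.
move: p_norm; set Q := \sum_(k < n | _) `|- p k| => p_norm err.
pose q := (1 + u) ^+ c.
have q_ge1 : 1 <= q by apply: exprn_ege1.
have q_le : (1 + u) * q - 1 <= g.
  by apply: le_trans prod_le; rewrite lerD2r -exprS ler_weXn2l.
have a_norm : `|A i j * (1 + d)| <= (1 + u) * `|A i j|.
  by rewrite mulrC normrM ler_wpM2r // d1.
have a_err : `|A i j * d| <= u * `|A i j| by rewrite mulrC normrM ler_wpM2r.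
have -> : s - (A i j - S) =
    (s - (A i j * (1 + d) + P)) + A i j * d + (P + S) by ring.
apply: le_trans (ler_normD _ _) _.
apply: le_trans (lerD (ler_normD _ _) p_sum) _.
apply: le_trans (lerD (lerD err a_err) (lexx _)) _.
apply: (@le_trans _ _ (((1 + u) * q - 1) * (`|A i j| + T))); last first.
  by rewrite ler_wpM2r // addr_ge0.
have -> : ((1 + u) * q - 1) * (`|A i j| + T) =
    (q - 1) * ((1 + u) * `|A i j| + (1 + u) * T) + u * `|A i j| + u * T by ring.
rewrite !lerD2r ler_wpM2l ?subr_ge0 //; exact: lerD.
Qed.

(** Triangularity kills the indices beyond [j]. Both the identity and the norm are needed as [F]. *)
Lemma cholesky_dot_split (F : R -> R) (i j : 'I_n) : F 0 = 0 ->
  \sum_k F (L i k * L j k) =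
    \sum_(k < n | (k < j)%N) F (L i k * L j k) + F (L i j * L j j).
Proof.
move=> F0; rewrite (bigID (fun k : 'I_n => (k < j)%N)) /=; congr (_ + _).
rewrite (bigD1 j) ?ltnn //= big1 ?addr0 // => k; rewrite -leqNgt => /andP[jk kj].
by rewrite (L_chol.1 j k) ?mulr0 // ltn_neqAle jk andbT eq_sym.
Qed.

Lemma computed_cholesky_residual (i j : 'I_n) : (j <= i)%N -> L j j != 0 ->
  `|A i j - \sum_k L i k * L j k| <=
    g * (`|A i j| + \sum_k `|L i k * L j k|).
Proof.
move=> ji Ljj; have [Al Al_round /(_ i j ji)[p [s [p_round s_round Lij]]]] := L_chol.2.
have := computed_difference_error (Al_round i j) p_round s_round.
rewrite (cholesky_dot_split (F := id)) // (cholesky_dot_split (F := Num.norm)) ?normr0 //.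
set S := \sum_(k < n | _) L i k * _; set T := \sum_(k < n | _) `|L i k * _|.
have [[g_ge0 u0] u1] := (computed_cholesky_g_ge0, u_ge0, u_lt1).
(* What remains is the rounding of the division or of the square root; [quot_le] makes the same [g]
   cover it. *)
suff last_err : `|s - L i j * L j j| <= g * `|L i j * L j j|.
  move=> err.
  have -> : A i j - (S + L i j * L j j) =
      - (s - (A i j - S)) + (s - L i j * L j j) by ring.
  apply: le_trans (ler_normD _ _) _; rewrite normrN addrA mulrDr; exact: lerD.
have [ij|ij] := eqVneq i j; last first.
  case: Lij => d d_le; rewrite (negbTE ij) => ->.
  have -> : s / L j j * (1 + d) * L j j = s * (1 + d) by field.
  have -> : s - s * (1 + d) = - (d * s) by ring.
  rewrite normrN normrM [_ * (1 + d)]mulrC normrM mulrA ler_wpM2r //.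
  have d1_ge : 1 - u <= 1 + d by move: d_le; rewrite ler_norml; lra.
  apply: le_trans d_le _; rewrite ger0_norm; last by apply: le_trans d1_ge; lra.
  (* This is [1 <= (1 + g) * (1 - u)] rearranged, a weakening of [quot_le]. *)
  have u_le : u <= g * (1 - u).
    have : (1 + g) * (1 - u) ^+ 2 <= (1 + g) * (1 - u).
      by rewrite ler_wpM2l ?ler_iXnr //; lra.
    by have := quot_le; lra.
  by apply: le_trans u_le _; rewrite ler_wpM2l //; lra.
move: Lij Ljj; rewrite ij eqxx => -[d d_le ->].
rewrite mulf_eq0 negb_or => /andP[s_neq0 _].
have s_gt0 : 0 < s by rewrite ltNge; apply: contraNN s_neq0 => /ler0_sqrtr ->.
have -> : Num.sqrt s * (1 + d) * (Num.sqrt s * (1 + d)) = (1 + d) ^+ 2 * s.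
  by rewrite -[s in RHS](sqr_sqrtr (ltW s_gt0)); ring.
have -> : s - (1 + d) ^+ 2 * s = - ((2 * d + d ^+ 2) * s) by ring.
rewrite normrN !normrM mulrA ler_wpM2r //.
have [d1 d2] : - u <= d /\ d <= u by move: d_le; rewrite ler_norml => /andP.
rewrite -expr2 real_normK ?num_real //.
(* The goal amounts to [(1 - g) * (1 + d) ^+ 2 <= 1 <= (1 + g) * (1 + d) ^+ 2]. The right half comes
   from [quot_le], the left from [1 - g <= (1 - u) ^+ 2] and [(1 - u ^+ 2) ^+ 2 <= 1]. *)
have [lo hi] : (1 - u) ^+ 2 <= (1 + d) ^+ 2 /\ (1 + d) ^+ 2 <= (1 + u) ^+ 2.
  by split; rewrite ler_sqr ?nnegrE; lra.
have lo_g : (1 + g) * (1 - u) ^+ 2 <= (1 + g) * (1 + d) ^+ 2.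
  by rewrite ler_wpM2l //; lra.
have u_cancel : (1 - u) ^+ 2 * (1 + u) ^+ 2 <= 1.
  have -> : (1 - u) ^+ 2 * (1 + u) ^+ 2 = (1 - u ^+ 2) ^+ 2 by ring.
  by rewrite expr_le1 // ?gerBl ?sqr_ge0 // subr_ge0 expr_le1 // ltW.
have g_u : 1 - g <= (1 - u) ^+ 2.
  by rewrite -(ler_pM2l (_ : 0 < 1 + g)); [have := quot_le; nra | lra].
have hi_g : (1 - g) * (1 + d) ^+ 2 <= (1 - u) ^+ 2 * (1 + u) ^+ 2.
  apply: (@le_trans _ _ ((1 - u) ^+ 2 * (1 + d) ^+ 2)).
    by rewrite ler_wpM2r ?sqr_ge0.
  by rewrite ler_wpM2l ?sqr_ge0.
by rewrite ler_norml; have := quot_le; lra.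
Qed.

(** As [u < 1], a zero result forces [Num.sqrt s = 0], hence [s <= 0], and the error bound for [s]
    does the rest. *)
Lemma computed_cholesky_breakdown (j : 'I_n) : 0 <= A j j -> L j j = 0 ->
  (1 - g) * A j j <= (1 + g) * \sum_k L j k ^+ 2.
Proof.
move=> Ajj Ljj; have u1 := u_lt1.
have [Al Al_round /(_ j j (leqnn _))[p [s [p_round s_round]]]] := L_chol.2.
have := computed_difference_error (Al_round j j) p_round s_round.
have -> : \sum_k L j k ^+ 2 = \sum_k L j k * L j k.
  by apply: eq_bigr => k _; rewrite expr2.
rewrite (cholesky_dot_split (F := id)) //= Ljj mulr0 addr0 eqxx (ger0_norm Ajj).
have -> : \sum_(k < n | (k < j)%N) `|L j k * L j k| =
    \sum_(k < n | (k < j)%N) L j k * L j k.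
  by apply: eq_bigr => k _; rewrite ger0_norm // -expr2 sqr_ge0.
set S := \sum_(k < n | _) _ => err [d d_le] /esym/eqP.
rewrite mulf_eq0 => /orP[s_le0|/eqP]; last by case/ler_normlP: d_le; lra.
have {}s_le0 : s <= 0 by rewrite sqrtr_eq0 in s_le0.
by case/ler_normlP: err; lra.
Qed.

End CholeskyRounding.

(** * Bilinear forms with rank-one entrywise bounds *)

Section BilinearForms.
Variable R : realType.

Lemma bilinear_sum n (E : 'M[R]_n) (v w : 'cV[R]_n) :
  (v^T *m E *m w) ord0 ord0 = \sum_i \sum_j v i ord0 * E i j * w j ord0.
Proof.
rewrite -mulmxA mxE; apply: eq_bigr => i _.
by rewrite !mxE mulr_sumr; apply: eq_bigr => j _; rewrite mulrA.
Qed.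

Lemma weighted_abs_sum_le n (b : 'I_n -> R) (v : 'cV[R]_n) :
  \sum_i `|v i ord0| * b i <= Num.sqrt (\sum_i b i ^+ 2) * enorm v.
Proof.
have b_ge0 : 0 <= \sum_i b i ^+ 2 by apply: sumr_ge0 => i _; rewrite sqr_ge0.
apply: le_trans (ler_norm _) _.
rewrite -ler_sqr ?nnegrE ?mulr_ge0 ?sqrtr_ge0 ?enorm_ge0 //.
rewrite exprMn sqr_sqrtr // real_normK ?num_real // enorm_sqr mulrC.
apply: le_trans (cauchy_schwarz_sum _ _) _.
by under eq_bigr do rewrite real_normK ?num_real //.
Qed.

Lemma weighted_abs_prod_le n (b : 'I_n -> R) (v w : 'cV[R]_n) :
  (forall i, 0 <= b i) ->
  (\sum_i `|v i ord0| * b i) * (\sum_i `|w i ord0| * b i) <=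
    (\sum_i b i ^+ 2) * (enorm v * enorm w).
Proof.
move=> b_ge0; have sum_ge0 x : 0 <= \sum_i `|(x : 'cV[R]_n) i ord0| * b i.
  by apply: sumr_ge0 => i _; rewrite mulr_ge0.
have b2_ge0 : 0 <= \sum_i b i ^+ 2 by apply: sumr_ge0 => i _; rewrite sqr_ge0.
apply: le_trans (ler_pM _ _ (weighted_abs_sum_le b v) (weighted_abs_sum_le b w)) _ => //.
by rewrite mulrACA -expr2 sqr_sqrtr.
Qed.

Lemma abs_prod_le n (v w : 'cV[R]_n) :
  (\sum_i `|v i ord0|) * (\sum_i `|w i ord0|) <= n%:R * (enorm v * enorm w).
Proof.
have := @weighted_abs_prod_le n (fun=> 1) v w (fun=> ler01).
rewrite expr1n sumr_const card_ord.
by under eq_bigr do rewrite mulr1; under [X in _ * X]eq_bigr do rewrite mulr1.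
Qed.

Lemma rank_one_bound_sum n (m c : R) (b : 'I_n -> R) (v w : 'cV[R]_n) :
  \sum_i \sum_j c * (m * (`|v i ord0| * `|w j ord0|) +
                     (`|v i ord0| * b i) * (`|w j ord0| * b j)) =
  c * (m * ((\sum_i `|v i ord0|) * (\sum_i `|w i ord0|)) +
       (\sum_i `|v i ord0| * b i) * (\sum_i `|w i ord0| * b i)).
Proof.
rewrite !big_distrlr /= mulrDr mulrA !mulr_sumr -big_split /=.
apply: eq_bigr => i _; rewrite !mulr_sumr -big_split /=.
by apply: eq_bigr => j _; ring.
Qed.

(** The entrywise bound is a sum of two rank-one matrices, so the double sum factors and
    Cauchy-Schwarz applies to each factor. *)
Lemma bilinear_le n (E : 'M[R]_n) (c m : R) (b : 'I_n -> R) (v w : 'cV[R]_n) :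
  0 <= c -> 0 <= m -> (forall i, 0 <= b i) ->
  (forall i j, `|E i j| <= c * (m + b i * b j)) ->
  `|(v^T *m E *m w) ord0 ord0| <=
    c * (n%:R * m + \sum_i b i ^+ 2) * (enorm v * enorm w).
Proof.
move=> c_ge0 m_ge0 b_ge0 E_le; rewrite bilinear_sum.
apply: le_trans (ler_norm_sum _ _ _) _.
have le2 i : `|\sum_j v i ord0 * E i j * w j ord0| <=
  \sum_j c * (m * (`|v i ord0| * `|w j ord0|) +
                     (`|v i ord0| * b i) * (`|w j ord0| * b j)).
  apply: le_trans (ler_norm_sum _ _ _) _; apply: ler_sum => j _.
  rewrite !normrM.
  have -> : c * (m * (`|v i ord0| * `|w j ord0|) + `|v i ord0| * b i * (`|w j ord0| * b j))
    = `|v i ord0| * (c * (m + b i * b j)) * `|w j ord0| by ring.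
  by rewrite ler_wpM2r // ler_wpM2l.
apply: le_trans (ler_sum _ (fun i _ => le2 i)) _.
rewrite rank_one_bound_sum -mulrA ler_wpM2l //.
rewrite mulrDl lerD ?weighted_abs_prod_le //.
by rewrite [n%:R * m]mulrC -mulrA ler_wpM2l // abs_prod_le.
Qed.

(** The choice [v = E *m w] suffices. *)
Lemma bilinear_bound_op n (E : 'M[R]_n) (c : R) : 0 <= c ->
  (forall v w : 'cV[R]_n, `|(v^T *m E *m w) ord0 ord0| <= c * (enorm v * enorm w)) ->
  forall w : 'cV[R]_n, enorm (E *m w) <= c * enorm w.
Proof.
move=> c_ge0 E_le w; have := E_le (E *m w) w.
rewrite -mulmxA -enorm_sqrE ger0_norm ?sqr_ge0 //.
have [->|Ew] := eqVneq (enorm (E *m w)) 0; first by rewrite mulr_ge0 ?enorm_ge0.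
have Ew_gt0 : 0 < enorm (E *m w) by rewrite lt0r Ew enorm_ge0.
by rewrite mulrCA expr2 ler_pM2l.
Qed.

Lemma form_delta n (A : 'M[R]_n) (i j : 'I_n) :
  ((delta_mx i ord0 : 'cV[R]_n)^T *m A *m (delta_mx j ord0 : 'cV[R]_n)) ord0 ord0 = A i j.
Proof. by rewrite trmx_delta -rowE -colE !mxE. Qed.

Lemma enorm_delta n (i : 'I_n) : enorm (delta_mx i ord0 : 'cV[R]_n) ^+ 2 = 1.
Proof. by rewrite enorm_sqrE -[_^T]mulmx1 form_delta mxE eqxx. Qed.

(** Nonnegativity at [e i + e j] and [e i - e j] bounds [2 * |A i j|] by [A i i + A j j]. *)
Lemma form_entry_le n (A : 'M[R]_n) (m : R) (i j : 'I_n) : A^T = A ->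
  (forall x : 'cV[R]_n, 0 <= (x^T *m A *m x) ord0 ord0 <= m * enorm x ^+ 2) ->
  `|A i j| <= m.
Proof.
move=> A_sym A_bnd.
pose e k : 'cV[R]_n := delta_mx k ord0.
have diag_le k : A k k <= m.
  by have /andP[_] := A_bnd (e k); rewrite form_delta enorm_delta mulr1.
have Aji : A j i = A i j by rewrite -[in LHS]A_sym mxE.
have off t : 0 <= A i i + 2 * t * A i j + t ^+ 2 * A j j.
  have /andP[] := A_bnd (e i + t *: e j).
  have -> : (e i + t *: e j)^T = (e i)^T + t *: (e j)^T.
    by rewrite linearD linearZ.
  rewrite !mulmxDl !mulmxDr -!scalemxAl -!scalemxAr.
  have addE (a b : 'M[R]_1) : (a + b) ord0 ord0 = a ord0 ord0 + b ord0 ord0.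
    by rewrite mxE.
  have scaleE c (b : 'M[R]_1) : (c *: b) ord0 ord0 = c * b ord0 ord0 by rewrite mxE.
  rewrite !addE !scaleE !form_delta Aji => H _.
  by move: H; congr (_ <= _); ring.
have := off 1; have := off (-1); have := diag_le i; have := diag_le j.
by rewrite ler_norml expr1n sqrrN expr1n; lra.
Qed.

End BilinearForms.

(** * Absence of breakdown and backward error *)

Section Pivots.
Variables (R : realType) (n : nat) (A L : 'M[R]_n) (l m g : R).
Hypotheses (A_sym : A^T = A) (l_gt0 : 0 < l) (g_ge0 : 0 <= g).
Hypothesis (g_le : n%:R * g * m <= l / 7).
Hypothesis (A_bnd : forall x : 'cV[R]_n,
  l * enorm x ^+ 2 <= (x^T *m A *m x) ord0 ord0 <= m * enorm x ^+ 2).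
Hypothesis (L_trig : forall i j : 'I_n, (i < j)%N -> L i j = 0).
Hypothesis (L_res : forall i j : 'I_n, (j <= i)%N -> L j j != 0 ->
  `|A i j - \sum_k L i k * L j k| <= g * (`|A i j| + \sum_k `|L i k * L j k|)).
Hypothesis (L_breakdown : forall j : 'I_n, L j j = 0 ->
  (1 - g) * A j j <= (1 + g) * \sum_k L j k ^+ 2).

Local Notation r i := (Num.sqrt (\sum_k L i k ^+ 2)).

Local Lemma form_ge0 (x : 'cV[R]_n) :
  0 <= (x^T *m A *m x) ord0 ord0 <= m * enorm x ^+ 2.
Proof.
have /andP[lo ->] := A_bnd x; rewrite andbT (le_trans _ lo) //.
by rewrite mulr_ge0 ?sqr_ge0 // ltW.
Qed.

Local Lemma diag_bounds (i : 'I_n) : l <= A i i <= m.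
Proof. by have := A_bnd (delta_mx i ord0); rewrite form_delta enorm_delta !mulr1. Qed.

(** The index guarantees [1 <= n]; with [l <= A i i <= m], [g_le] then yields [g * m <= m / 7]. *)
Local Lemma g_small (i : 'I_n) : g <= 1 / 7 /\ g * m <= n%:R * g * m.
Proof.
have /andP[lA Am] := diag_bounds i.
have [l0 gle g0] : [/\ 0 < l, n%:R * g * m <= l / 7 & 0 <= g] by [].
have n1 : (1 : R) <= n%:R by rewrite ler1n; apply: leq_ltn_trans (ltn_ord i).
have gm : g * m <= n%:R * g * m.
  by rewrite -mulrA ler_peMl // mulr_ge0 //; lra.
split=> //; rewrite leNgt; apply/negP => g_big; nra.
Qed.

Local Lemma row_norm_sqr i : r i ^+ 2 = \sum_k L i k ^+ 2.
Proof. by rewrite sqr_sqrtr // sumr_ge0 // => k _; rewrite sqr_ge0. Qed.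

(** The hypotheses ask for a nonzero pivot at the smaller of the two indices, so the bound is usable
    while later pivots are still unknown. *)
Local Lemma residual_le (i j : 'I_n) :
  ((i <= j)%N -> L i i != 0) -> ((j <= i)%N -> L j j != 0) ->
  `|A i j - \sum_k L i k * L j k| <= g * (m + r i * r j).
Proof.
wlog ji : i j / (j <= i)%N => [H Li Lj|_ /(_ ji) Ljj].
  have [ij|/ltnW ji] := leqP i j; last exact: H.
  have Aji : A i j = A j i by rewrite -[in LHS]A_sym mxE.
  rewrite Aji [r i * _]mulrC; under eq_bigr do rewrite mulrC.
  exact: H.
apply: le_trans (L_res ji Ljj) _; rewrite ler_wpM2l // lerD //.
  by apply: form_entry_le A_sym form_ge0.
pose absrow k : 'cV[R]_n := \col_p `|L k p|.
have absrowE k : enorm (absrow k) = r k.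
  congr Num.sqrt; apply: eq_bigr => p _.
  by rewrite mxE real_normK // num_real.
rewrite -!absrowE; apply: le_trans (dot_le_enorm _ _).
apply: le_trans (ler_norm _); rewrite mxE.
by apply: ler_sum => p _; rewrite !mxE normrM.
Qed.

(** The diagonal residual gives [(1 - g) * r i ^+ 2 <= (1 + g) * m], and [4 / 3] is
    [(1 + g) / (1 - g)] at [g = 1 / 7]. *)
Local Lemma row_norm_sqr_le i : L i i != 0 -> r i ^+ 2 <= 4 / 3 * m.
Proof.
move=> Lii; have := @residual_le i i (fun=> Lii) (fun=> Lii).
rewrite [X in A i i - X](_ : _ = r i ^+ 2) -?expr2; last first.
  by rewrite row_norm_sqr; apply: eq_bigr => k _; rewrite expr2.
 have /andP[lA Am] := diag_bounds i.
have [g7 _] := g_small i; have [l0 g0] : 0 < l /\ 0 <= g by [].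
have := sqr_ge0 (r i); set s := r i ^+ 2 => s_ge0.
have : g * (m + s) <= 1 / 7 * (m + s) by rewrite ler_wpM2r //; lra.
by rewrite ler_norml => gs /andP[h _]; lra.
Qed.

(* x is a kernel vector of L with the rows below j replaced by those of the
   identity, which forces the support condition. *)
Local Lemma singular_factor_kernel (j : 'I_n) : L j j = 0 ->
  exists x : 'cV[R]_n, [/\ x != 0, forall i : 'I_n, (j < i)%N -> x i ord0 = 0
    & forall k, \sum_i x i ord0 * L i k = 0].
Proof.
move=> Ljj; pose N : 'M[R]_n := \matrix_(i, k) if (i <= j)%N then L i k else (i == k)%:R.
have N_trig : is_trig_mx N.
  apply/is_trig_mxP => i k ik; rewrite mxE; case: leqP => _; first exact: L_trig.
  by rewrite -val_eqE /= ltn_eqF.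
have : \det N == 0.
  by rewrite det_trig // (bigD1 j) //= mxE leqnn Ljj mul0r.
move/det0P => [v v_neq0 vN].
have v_supp (i : 'I_n) : (j < i)%N -> v ord0 i = 0.
  move=> ji; have /matrixP/(_ ord0 i) := vN.
  rewrite !mxE (bigD1 i) //= mxE leqNgt ji /= eqxx mulr1 big1 ?addr0 // => k ki.
  rewrite mxE; case: leqP => [kj|_]; last by rewrite (negbTE ki) mulr0.
  by rewrite L_trig ?mulr0 // (leq_ltn_trans kj).
exists v^T; split=> [|i ji|k].
- by rewrite -trmx0 (inj_eq trmx_inj).
- by rewrite mxE v_supp.
have /matrixP/(_ ord0 k) := vN; rewrite !mxE => vNk.
have [jk|kj] := ltnP j k.
  rewrite big1 // => i _; rewrite mxE; have [ji|ij] := ltnP j i.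
    by rewrite v_supp ?mul0r.
  by rewrite L_trig ?mulr0 // (leq_ltn_trans ij).
rewrite -[RHS]vNk; apply: eq_bigr => i _; rewrite !mxE; have [ij|ji] := leqP i j => //.
by rewrite v_supp // !mul0r.
Qed.

(** Since [x^T *m L = 0], subtracting [L *m L^T] from [A] leaves the form at [x] unchanged. *)
Local Lemma form_residual (x : 'cV[R]_n) : (forall k, \sum_i x i ord0 * L i k = 0) ->
  (x^T *m A *m x) ord0 ord0 =
    \sum_i \sum_j x i ord0 * (A i j - \sum_k L i k * L j k) * x j ord0.
Proof.
move=> xL; rewrite bilinear_sum; apply/eqP; rewrite -subr_eq0 -sumrB; apply/eqP.
transitivity (\sum_k (\sum_i x i ord0 * L i k) * (\sum_j x j ord0 * L j k)).
  under [RHS]eq_bigr do rewrite big_distrlr /=.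
  rewrite [RHS]exchange_big; apply: eq_bigr => i _.
  rewrite -sumrB [RHS]exchange_big; apply: eq_bigr => j _.
  transitivity (x i ord0 * x j ord0 * \sum_k L i k * L j k); first by ring.
  by rewrite mulr_sumr; apply: eq_bigr => k _; ring.
by rewrite big1 // => k _; rewrite xL mul0r.
Qed.

(** Strong induction on the index: the pivots already known to be nonzero supply the residual bounds
    that make the kernel vector of a zero pivot contradict the lower bound [l]. *)
Lemma cholesky_pivot_neq0 (j : 'I_n) : L j j != 0.
Proof.
have [b] := ubnP (j : nat); elim: b j => // b IH j; rewrite ltnS => jb.
have {}IH (i : 'I_n) : (i < j)%N -> L i i != 0.
  by move=> ij; apply: IH; apply: leq_trans jb.
apply/negP => /eqP Ljj.
have [x [x_neq0 x_supp xL]] := singular_factor_kernel Ljj.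
have /andP[Ax _] := A_bnd x; rewrite (form_residual xL) in Ax.
have r_ge0 i : 0 <= r i by exact: sqrtr_ge0.
have /andP[lA Am] := diag_bounds j.
have m_gt0 : 0 < m by apply: lt_le_trans (le_trans lA Am).
pose D := A j j - r j ^+ 2.
(* No residual bound is available at (j, j), where only the failed square root
   is known; that entry is kept exactly. *)
pose corner (i i' : 'I_n) :=
  if (i == j) && (i' == j) then x j ord0 ^+ 2 * (D - g * r j ^+ 2) else 0.
have term_le i i' : x i ord0 * (A i i' - \sum_k L i k * L i' k) * x i' ord0 <=
    g * (m * (`|x i ord0| * `|x i' ord0|) +
      (`|x i ord0| * r i) * (`|x i' ord0| * r i')) + corner i i'.
  have main_ge0 : 0 <= g * (m * (`|x i ord0| * `|x i' ord0|) +
      (`|x i ord0| * r i) * (`|x i' ord0| * r i')).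
    have m_ge0 := ltW m_gt0.
    by rewrite mulr_ge0 // addr_ge0 ?mulr_ge0.
  rewrite /corner; case: ifP => [/andP[/eqP ij /eqP i'j]|corner_false].
    rewrite {}ij {}i'j in main_ge0 *.
    rewrite [X in A j j - X](_ : _ = r j ^+ 2); last first.
      by rewrite row_norm_sqr; apply: eq_bigr => k _; rewrite expr2.
    have -> : x j ord0 * (A j j - r j ^+ 2) * x j ord0 = x j ord0 ^+ 2 * D.
      by rewrite /D; ring.
    have -> : `|x j ord0| * r j * (`|x j ord0| * r j) = x j ord0 ^+ 2 * r j ^+ 2.
      by rewrite -[x j ord0 ^+ 2]real_normK ?num_real //; ring.
    (* The term [- g * r j ^+ 2] of [corner] cancels the row-norm part of the generic bound; this
       nonnegative part remains. *)
    have : 0 <= g * (m * (`|x j ord0| * `|x j ord0|)).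
      by rewrite !mulr_ge0 // ltW.
    by lra.
  rewrite addr0.
  have [xi|xi] := eqVneq (x i ord0) 0; first by rewrite {1}xi !mul0r.
  have [xi'|xi'] := eqVneq (x i' ord0) 0; first by rewrite {1}xi' mulr0.
  have ij : (i <= j)%N by rewrite leqNgt; apply: contraNN xi => /x_supp ->.
  have i'j : (i' <= j)%N by rewrite leqNgt; apply: contraNN xi' => /x_supp ->.
  (* Away from the corner the smaller of [i] and [i'] is below [j], where [IH] gives the pivot. *)
  have res : `|A i i' - \sum_k L i k * L i' k| <= g * (m + r i * r i').
    apply: residual_le => ii'; apply: IH; rewrite ltn_neqAle ?ij ?i'j andbT;
      apply: contraFN corner_false => /eqP eij; rewrite -!val_eqE /= eij eqxx ?andbT;
      by rewrite eqn_leq ?ij ?i'j -eij.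
  apply: le_trans (ler_norm _) _; rewrite !normrM.
  have -> : g * (m * (`|x i ord0| * `|x i' ord0|) +
      `|x i ord0| * r i * (`|x i' ord0| * r i')) =
      `|x i ord0| * (g * (m + r i * r i')) * `|x i' ord0| by ring.
  by rewrite ler_wpM2r // ler_wpM2l.
have {}Ax := le_trans Ax (ler_sum _ (fun i _ => ler_sum _ (fun i' _ => term_le i i'))).
(* Row [j] has a zero pivot, so [row_norm_sqr_le] does not reach it and it is split off; beyond [j]
   the entries of [x] vanish. *)
pose r' (i : 'I_n) := if (i < j)%N then r i else 0.
have sum_r' : \sum_i `|x i ord0| * r i = \sum_i `|x i ord0| * r' i + `|x j ord0| * r j.
  rewrite (bigD1 j) //= [in RHS](bigD1 j) //= /r' ltnn mulr0 add0r addrC.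
  congr (_ + _); apply: eq_bigr => i ij; have [//|ji] := ltnP i j.
  by rewrite x_supp ?normr0 ?mul0r // ltn_neqAle ji eq_sym andbT.
have sum_corner : \sum_i \sum_i' corner i i' = x j ord0 ^+ 2 * (D - g * r j ^+ 2).
  rewrite (bigD1 j) //= [X in _ + X]big1 ?addr0 => [|i /negbTE ij]; last first.
    by rewrite big1 // => k _; rewrite /corner ij.
  rewrite (bigD1 j) //= [X in _ + X]big1 ?addr0 => [|i /negbTE ij].
    by rewrite /corner !eqxx.
  by rewrite /corner ij andbF.
have r'_bnd : \sum_i r' i ^+ 2 <= n%:R * (4 / 3 * m).
  have -> : n%:R * (4 / 3 * m) = \sum_(i < n) (4 / 3 * m).
    by rewrite sumr_const card_ord mulr_natl.
  apply: ler_sum => i _; rewrite /r'; case: ifP => [/IH/row_norm_sqr_le //|_].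
  by rewrite expr0n !mulr_ge0 ?invr_ge0 // ltW.
have r'_ge0 i : 0 <= r' i by rewrite /r'; case: ifP.
have T_le := weighted_abs_prod_le x x r'_ge0.
have S_le := abs_prod_le x x.
have xj_le : x j ord0 ^+ 2 <= enorm x ^+ 2.
  by rewrite enorm_sqr (bigD1 j) //= lerDl sumr_ge0 // => i _; rewrite sqr_ge0.
have X_gt0 : 0 < enorm x ^+ 2 by rewrite exprn_gt0 // enorm_gt0.
have brk := L_breakdown Ljj; rewrite -row_norm_sqr in brk.
move: Ax; under eq_bigr do rewrite big_split /=.
rewrite big_split /= rank_one_bound_sum sum_corner sum_r'.
have -> : x j ord0 ^+ 2 = `|x j ord0| ^+ 2 by rewrite real_normK ?num_real.
rewrite -[x j ord0 ^+ 2]real_normK ?num_real // in xj_le.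
rewrite -expr2 in T_le S_le.
move: T_le S_le xj_le X_gt0 brk; rewrite /D.
set T := \sum_i `|x i ord0| * r' i; set S := \sum_i `|x i ord0|; rewrite -!expr2.
set X := enorm x ^+ 2; set t := `|x j ord0|; set p := r j ^+ 2.
move=> T_le S_le xj_le X_gt0 brk Ax.
have [g7 gm] := g_small j.
have [l0 gle g0] : [/\ 0 < l, n%:R * g * m <= l / 7 & 0 <= g] by [].
(* The breakdown inequality gives [p >= (1 - g) / (1 + g) * A j j], so the left side is at most
   [(3 * g - g ^+ 2) / (1 + g) * A j j]. *)
have pivot_le : A j j - (1 - g) * p <= 3 * g * m.
  rewrite -(ler_pM2l (_ : 0 < 1 + g)); last by lra.
  by nra.
have T2 : g * T ^+ 2 <= 4 / 3 * (n%:R * g * m) * X.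
  have -> : 4 / 3 * (n%:R * g * m) * X = g * (n%:R * (4 / 3 * m) * X) by ring.
  rewrite ler_wpM2l //; apply: le_trans T_le _; rewrite ler_wpM2r // ltW //.
have S2 : g * (m * S ^+ 2) <= n%:R * g * m * X.
  have -> : n%:R * g * m * X = g * (m * (n%:R * X)) by ring.
  by rewrite ler_wpM2l // ler_wpM2l // ltW.
have last : t ^+ 2 * (A j j - (1 - g) * p) <= 3 * (n%:R * g * m) * X.
  apply: (@le_trans _ _ (t ^+ 2 * (3 * g * m))).
    by rewrite ler_wpM2l ?sqr_ge0.
  have -> : 3 * (n%:R * g * m) * X = X * (3 * (n%:R * g * m)) by ring.
  by rewrite ler_pM ?sqr_ge0 ?mulr_ge0 //; lra.
(* The term [2 * g * (t ^+ 2 * p)] turns the corner factor [A j j - p - g * p] into the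
   [A j j - (1 - g) * p] of [pivot_le]. *)
have sq : g * (T + t * r j) ^+ 2 <= 2 * (g * T ^+ 2) + 2 * g * (t ^+ 2 * p).
  have -> : 2 * (g * T ^+ 2) + 2 * g * (t ^+ 2 * p) =
    g * ((T + t * r j) ^+ 2 + (T - t * r j) ^+ 2) by rewrite /p; ring.
  by rewrite ler_wpM2l // lerDl sqr_ge0.
(* The contributions [1] from [S2], [2 * (4 / 3)] from [T2] and [3] from [last] add up to [20 / 3],
   less than the [7] of [g_le]. *)
have : l * X <= 20 / 3 * (n%:R * g * m) * X by lra.
by rewrite ler_pM2r //; lra.
Qed.

(** With every pivot nonzero the residual bound holds at all entries; [7 / 3] is [1] from the
    entries of [A] plus [4 / 3] from the row norms. *)
Lemma cholesky_residual_op (w : 'cV[R]_n) : (0 < n)%N ->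
  enorm ((L *m L^T - A) *m w) <= 7 / 3 * (n%:R * g * m) * enorm w.
Proof.
move=> n_gt0; have m_gt0 : 0 < m.
  by have /andP[lA Am] := diag_bounds (Ordinal n_gt0); have := l_gt0; lra.
have [gm0 n0] : 0 <= n%:R * g * m /\ 0 <= n%:R :> R.
  by rewrite ler0n !mulr_ge0 // ltW.
apply: bilinear_bound_op => [|v {}w]; first by lra.
have r_ge0 i : 0 <= r i by exact: sqrtr_ge0.
have E_le i j : `|(L *m L^T - A) i j| <= g * (m + r i * r j).
  have -> : (L *m L^T - A) i j = - (A i j - \sum_k L i k * L j k).
    by rewrite !mxE opprB; congr (_ - _); apply: eq_bigr => k _; rewrite mxE.
  by rewrite normrN; apply: residual_le => _; apply: cholesky_pivot_neq0.
have := bilinear_le v w g_ge0 (ltW m_gt0) r_ge0 E_le.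
move/le_trans; apply; rewrite ler_wpM2r ?mulr_ge0 ?enorm_ge0 //.
have : \sum_i r i ^+ 2 <= n%:R * (4 / 3 * m).
  have -> : n%:R * (4 / 3 * m) = \sum_(i < n) (4 / 3 * m).
    by rewrite sumr_const card_ord mulr_natl.
  by apply: ler_sum => i _; apply/row_norm_sqr_le/cholesky_pivot_neq0.
have -> : 7 / 3 * (n%:R * g * m) = g * (n%:R * m + n%:R * (4 / 3 * m)) by field.
by move=> r_le; rewrite ler_wpM2l // lerD2l.
Qed.

End Pivots.

(** * The preconditioner *)

Section Preconditioner.
Variable R : realType.

Lemma posdefmx_unit n (C : 'M[R]_n) : posdefmx C -> C \in unitmx.
Proof.
move=> [_ C_pos]; rewrite unitmxE unitfE; apply/det0P => -[v v_neq0 vC].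
have := C_pos v^T; rewrite trmxK vC mul0mx mxE ltxx -trmx0 (inj_eq trmx_inj).
by move=> /(_ v_neq0).
Qed.

Lemma precond_invE n (L : 'M[R]_n) : L \in unitmx ->
  precond_inv L = invmx (L *m L^T).
Proof.
move=> L_unit; have LT_unit : L^T \in unitmx by rewrite unitmx_tr.
have LLT_unit : L *m L^T \in unitmx by rewrite unitmx_mul L_unit.
apply: (can_inj (mulKmx LLT_unit)); rewrite mulmxV // /precond_inv.
by rewrite -mulmxA mulKVmx // mulmxV.
Qed.

Lemma precondE n (L : 'M[R]_n) : L \in unitmx -> precond L = L *m L^T.
Proof. by move=> L_unit; rewrite /precond precond_invE // invmxK. Qed.

Lemma norm_wrt_gram n (L : 'M[R]_n) (v : 'cV[R]_n) :
  norm_wrt (L *m L^T) v = enorm (L^T *m v).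
Proof.
have -> : enorm (L^T *m v) = Num.sqrt (enorm (L^T *m v) ^+ 2).
  by rewrite sqrtr_sqr ger0_norm ?enorm_ge0.
by rewrite enorm_sqrE trmx_mul trmxK /norm_wrt !mulmxA.
Qed.

Lemma norm_wrt_precond_inv n (L : 'M[R]_n) (v : 'cV[R]_n) :
  norm_wrt (precond_inv L) v = enorm (invmx L *m v).
Proof. by rewrite /precond_inv -trmx_inv -{2}[invmx L]trmxK norm_wrt_gram trmxK. Qed.

Lemma preconditioned_error n (A S B : 'M[R]_n) (l e : R) :
  S^T = S -> S *m S = A -> S \in unitmx -> B \in unitmx ->
  0 < l -> 0 <= e < 1 ->
  (forall v : 'cV[R]_n, l * enorm v ^+ 2 <= (v^T *m A *m v) ord0 ord0) ->
  (forall w : 'cV[R]_n, enorm ((B - A) *m w) <= e * l * enorm w) ->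
  forall x : 'cV[R]_n,
    enorm ((1%:M - S *m invmx B *m S) *m x) <= e / (1 - e) * enorm x.
Proof.
move=> S_sym SS S_unit B_unit l_gt0 /andP[e_ge0 e_lt1] A_lo E_le x.
have inv_le (w : 'cV[R]_n) : l * enorm (invmx S *m w) ^+ 2 <= enorm w ^+ 2.
  apply: le_trans (A_lo _) _; rewrite -SS mulmxA.
  set v := invmx S *m w; have Sv : S *m v = w by rewrite mulKVmx.
  by rewrite -[X in X <= _]/((v^T *m S *m S *m v) ord0 ord0) -mulmxA Sv
    -[S in v^T *m S]S_sym -trmx_mul Sv enorm_sqrE.
pose F := invmx S *m (B - A) *m invmx S.
(* [inv_le] serves once for each factor [invmx S]; the two factors [1 / l] on squared norms cancel
   the [l ^+ 2] from [E_le]. *)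
have F_le z : enorm (F *m z) <= e * enorm z.
  have eql : 0 <= e * enorm z by rewrite mulr_ge0 ?enorm_ge0.
  rewrite -ler_sqr ?nnegrE ?enorm_ge0 // -(ler_pM2l l_gt0) -!mulmxA.
  apply: le_trans (inv_le _) _.
  have h := E_le (invmx S *m z).
  have hs : enorm ((B - A) *m (invmx S *m z)) ^+ 2 <=
      (e * l * enorm (invmx S *m z)) ^+ 2.
    by rewrite ler_sqr ?nnegrE ?mulr_ge0 ?enorm_ge0 // ltW.
  apply: le_trans hs _.
  have -> : (e * l * enorm (invmx S *m z)) ^+ 2 =
      (l * e ^+ 2) * (l * enorm (invmx S *m z) ^+ 2) by ring.
  have -> : l * (e * enorm z) ^+ 2 = l * e ^+ 2 * enorm z ^+ 2 by ring.
  by rewrite ler_wpM2l ?mulr_ge0 ?sqr_ge0 // ltW.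
set y := _ *m x.
have FE : 1%:M + F = invmx S *m B *m invmx S.
  have SAS : invmx S *m A *m invmx S = 1%:M.
    by rewrite -SS mulmxA mulVmx // mul1mx mulmxV.
  by rewrite /F mulmxBr mulmxBl SAS addrC subrK.
have inv1 : (1%:M + F) *m (S *m invmx B *m S) = 1%:M.
  by rewrite FE !mulmxA mulmxKV // mulmxK // mulVmx.
have FM : (1%:M + F) *m (1%:M - S *m invmx B *m S) = F.
  by rewrite mulmxBr mulmx1 inv1 addrC addKr.
(* This is [FM] applied to [x]; it leads to [(1 - e) * enorm y <= e * enorm x] without inverting
   [1%:M + F]. *)
have yE : y = F *m x - F *m y.
  by apply/eqP; rewrite eq_sym subr_eq eq_sym -{1}[y]mul1mx -mulmxDl /y mulmxA FM.
have y_le : enorm y <= e * (enorm x + enorm y).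
  rewrite {1}yE; apply: le_trans (enormD _ _) _; rewrite enormN mulrDr.
  exact: lerD.
have e1 : 0 < 1 - e by rewrite subr_gt0.
rewrite mulrAC ler_pdivlMr //; lra.
Qed.

Lemma spectral_norm_le n (M : 'M[R]_n) (c : R) : 0 <= c ->
  (forall x : 'cV[R]_n, enorm (M *m x) <= c * enorm x) -> spectral_norm M <= c.
Proof.
move=> c_ge0 M_le; apply: ge_sup.
  exists (enorm (M *m 0)); exists 0 => //=.
  by rewrite /enorm big1 ?sqrtr0 // => i _; rewrite mxE expr0n.
move=> _ [x x_le1 <-]; apply: le_trans (M_le x) _.
by rewrite ler_piMr.
Qed.

(** The difference [z] of the two sides satisfies [S *m z = - (Num.sqrt l *: z)], which positive
    definiteness of [S] allows only for [z = 0]. *)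
Lemma sqrtmx_eigenvector n (A S : 'M[R]_n) (l : R) (u : 'cV[R]_n) :
  is_sqrtmx A S -> 0 <= l -> A *m u = l *: u -> S *m u = Num.sqrt l *: u.
Proof.
move=> [[S_sym S_pos] SS] l_ge0 Au; apply/eqP; rewrite -subr_eq0.
set z := _ - _; apply/negPn/negP => z_neq0.
have Sz : S *m z = - (Num.sqrt l *: z).
  rewrite /z mulmxBr mulmxA SS Au -scalemxAr scalerBr scalerA -expr2 sqr_sqrtr //.
  by rewrite opprB.
have := S_pos z z_neq0; rewrite -mulmxA Sz mulmxN -scalemxAr mxE mxE -enorm_sqrE.
by rewrite oppr_gt0 ltNge mulr_ge0 ?sqrtr_ge0 ?sqr_ge0.
Qed.

Lemma cos_distortion_angle n (A S L : 'M[R]_n) (u : 'cV[R]_n) (l e : R) :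
  is_sqrtmx A S -> L \in unitmx -> 0 < l -> 0 <= e < 1 ->
  u != 0 -> A *m u = l *: u ->
  enorm ((L *m L^T - A) *m u) <= e * l * enorm u ->
  enorm ((1%:M - S *m precond_inv L *m S) *m u) <= e / (1 - e) * enorm u ->
  0 <= cos (distortion_angle (precond L) u) /\
  cos (distortion_angle (precond L) u) ^+ 2 <= 2 * e.
Proof.
move=> SP L_unit l_gt0 /andP[e_ge0 e_lt1] u_neq0 Au E_le M_le.
have [[S_sym S_pos] SS] := SP.
have Su := sqrtmx_eigenvector SP (ltW l_gt0) Au.
rewrite /distortion_angle [invmx _]invmxK precondE // norm_wrt_gram norm_wrt_precond_inv.
set p := enorm (L^T *m u); set q := enorm (invmx L *m u); set U := enorm u.
have U_gt0 : 0 < U by rewrite enorm_gt0.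
have e1 : 0 < 1 - e by rewrite subr_gt0.
have p_le : p ^+ 2 <= l * (1 + e) * U ^+ 2.
  have -> : p ^+ 2 = (u^T *m A *m u) ord0 ord0 + (u^T *m ((L *m L^T - A) *m u)) ord0 ord0.
    rewrite /p enorm_sqrE (_ : _ *m _ = u^T *m A *m u + u^T *m ((L *m L^T - A) *m u)).
      by rewrite [LHS]mxE.
    by rewrite trmx_mul trmxK mulmxBl mulmxBr !mulmxA addrC subrK.
  have -> : (u^T *m A *m u) ord0 ord0 = l * U ^+ 2.
    by rewrite -mulmxA Au -scalemxAr mxE -enorm_sqrE.
  have h1 := le_trans (ler_norm _) (dot_le_enorm u ((L *m L^T - A) *m u)).
  have h2 : U * enorm ((L *m L^T - A) *m u) <= U * (e * l * U) by rewrite ler_wpM2l // ltW.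
  have -> : l * (1 + e) * U ^+ 2 = l * U ^+ 2 + U * (e * l * U) by ring.
  by rewrite lerD2l; apply: le_trans h1 h2.
(* As [u] is an eigenvector of [S], [l * q ^+ 2] is the form of [S *m precond_inv L *m S] at [u],
   within [e / (1 - e) * U ^+ 2] of [U ^+ 2]; and [1 + e / (1 - e) = 1 / (1 - e)]. *)
have q_le : l * (1 - e) * q ^+ 2 <= U ^+ 2.
  have -> : l * (1 - e) * q ^+ 2 = (1 - e) * (l * q ^+ 2) by ring.
  have -> : l * q ^+ 2 = (u^T *m (S *m precond_inv L *m S *m u)) ord0 ord0.
    rewrite (_ : _ *m _ = (S *m u)^T *m precond_inv L *m (S *m u)); last first.
      by rewrite trmx_mul S_sym !mulmxA.
    have -> : (S *m u)^T = Num.sqrt l *: u^T by rewrite Su linearZ.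
    rewrite Su -!scalemxAl -scalemxAr scalerA -expr2 (sqr_sqrtr (ltW l_gt0)).
    rewrite [RHS]mxE; congr (_ * _).
    by rewrite /q enorm_sqrE trmx_mul /precond_inv trmx_inv !mulmxA.
  have -> : (u^T *m (S *m precond_inv L *m S *m u)) ord0 ord0 =
     U ^+ 2 - (u^T *m ((1%:M - S *m precond_inv L *m S) *m u)) ord0 ord0.
    rewrite /U enorm_sqrE (_ : u^T *m (S *m _ *m S *m u) =
        u^T *m u - u^T *m ((1%:M - S *m precond_inv L *m S) *m u)).
      by rewrite [LHS]mxE [X in _ + X]mxE.
    by rewrite mulmxBl mul1mx mulmxBr opprB addrC subrK.
  have := dot_le_enorm u ((1%:M - S *m precond_inv L *m S) *m u).
  rewrite ler_norml -/U => /andP[h1 _].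
  have h2 : U * enorm ((1%:M - S *m precond_inv L *m S) *m u) <= U * (e / (1 - e) * U).
    by rewrite ler_wpM2l // ltW.
  have h3 : U * (e / (1 - e) * U) = e / (1 - e) * U ^+ 2 by ring.
  move: h1 h2; rewrite {}h3; set d := (u^T *m (_ *m u)) ord0 ord0.
  move=> h1 h2.
  have h4 : (1 - e) * (U ^+ 2 - d) <= (1 - e) * (U ^+ 2 + e / (1 - e) * U ^+ 2).
    by rewrite (ler_wpM2l (ltW e1)) //; lra.
  by apply: le_trans h4 _; rewrite le_eqVlt; apply/orP; left; apply/eqP; field; lra.
(* The vectors [L^T *m u] and [invmx L *m u] have dot product [U ^+ 2]; Cauchy-Schwarz keeps the
   argument of [asin] at most 1. *)
have dot_le : U ^+ 2 <= p * q.
  have := le_trans (ler_norm _) (dot_le_enorm (L^T *m u) (invmx L *m u)).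
  by rewrite trmx_mul trmxK -!mulmxA mulKVmx // -enorm_sqrE.
have p_ge0 : 0 <= p by exact: enorm_ge0.
have q_ge0 : 0 <= q by exact: enorm_ge0.
have U2_gt0 : 0 < U ^+ 2 by rewrite exprn_gt0.
have pq_gt0 : 0 < p * q by apply: lt_le_trans dot_le.
have s_ge0 : 0 <= U ^+ 2 / (p * q) by rewrite divr_ge0 ?ltW.
have s_le1 : U ^+ 2 / (p * q) <= 1 by rewrite ler_pdivrMr // mul1r.
rewrite cos_asin; last by rewrite s_le1 andbT; apply: le_trans s_ge0; lra.
split; first exact: sqrtr_ge0.
rewrite sqr_sqrtr ?subr_ge0 ?expr_le1 //.
suff : 1 - 2 * e <= (U ^+ 2 / (p * q)) ^+ 2 by lra.
rewrite expr_div_n ler_pdivlMr ?exprn_gt0 //.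
have prod_le : (1 - e) * (p * q) ^+ 2 <= (1 + e) * (U ^+ 2) ^+ 2.
  rewrite -(ler_pM2l l_gt0).
  have -> : l * ((1 - e) * (p * q) ^+ 2) = p ^+ 2 * (l * (1 - e) * q ^+ 2) by ring.
  have -> : l * ((1 + e) * (U ^+ 2) ^+ 2) = (l * (1 + e) * U ^+ 2) * U ^+ 2 by ring.
  by rewrite ler_pM ?sqr_ge0 // !mulr_ge0 ?sqr_ge0 // ltW.
have pq2 : 0 <= (p * q) ^+ 2 by exact: sqr_ge0.
(* Here [(1 + e) * (1 - 2 * e) = 1 - e - 2 * e ^+ 2] is at most the [1 - e] of [prod_le]. *)
have : (1 + e) * ((1 - 2 * e) * (p * q) ^+ 2) <= (1 + e) * ((U ^+ 2) ^+ 2).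
  apply: le_trans prod_le; rewrite mulrA ler_wpM2r //.
  by have := sqr_ge0 e; lra.
by rewrite ler_pM2l //; lra.
Qed.

End Preconditioner.

(** * Choice of the constants and conclusion *)

(** By induction, from [(1 + u) * (1 - n.+1%:R * u) <= 1 - n%:R * u]; it bounds the power above once
    [n%:R * u < 1]. *)
Lemma one_plus_exp_le (R : realType) (u : R) n :
  0 <= u -> (1 + u) ^+ n * (1 - n%:R * u) <= 1.
Proof.
move=> u_ge0; elim: n => [|n IH]; first by rewrite expr0 mul0r subr0 mulr1.
apply: le_trans IH; rewrite exprSr -mulrA ler_wpM2l ?exprn_ge0 ?addr_ge0 //.
rewrite -[n.+1%:R]natr1.
have : 0 <= n%:R * u ^+ 2 by rewrite mulr_ge0 ?sqr_ge0.
by have := sqr_ge0 u; lra.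
Qed.

Theorem mainTheorem6 (R : realType) (n : nat) (A : 'M[R]_n)
  (lam : n.-tuple R) (ustar : 'cV[R]_n) (ul : R) (Lhat sqrtA : 'M[R]_n)
  (hn : (0 < n)%N)
  (hA : posdefmx A)
  (hlam : sorted_eigenvalues A lam)
  (hlam_gt0 : 0 < lam`_0)
  (hlam_simple : (1 < n)%N -> lam`_0 < lam`_1)
  (hustar_neq0 : ustar != 0)
  (hustar : A *m ustar = lam`_0 *: ustar)
  (hul : 0 < ul)
  (hLhat : computed_cholesky ul A Lhat)
  (hsqrtA : is_sqrtmx A sqrtA) :
  let B := precond Lhat in
  let epsl := 4 * n%:R * (3 * n%:R + 1) * (lam`_n.-1 / lam`_0) * ul in
  let phi := distortion_angle B ustar in
  epsl < 1 ->
  [/\ spectral_norm (1%:M - sqrtA *m invmx B *m sqrtA) <= epsl / (1 - epsl),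
      cos phi ^+ 2 <= 2 * epsl
    & cos phi <= Num.sqrt (2 * epsl)].
Proof.
move=> B epsl phi epsl_lt1.
have [[A_sym A_pos] [S_posdef SS]] := (hA, hsqrtA).
have A_bnd := rayleigh_bounds A_sym hlam.
set l := lam`_0 in hlam_gt0 hustar A_bnd epsl epsl_lt1 *.
set m := lam`_n.-1 in A_bnd epsl epsl_lt1 *.
have l_le_m : l <= m.
  have U_gt0 : 0 < enorm ustar ^+ 2 by rewrite exprn_gt0 ?enorm_gt0.
  by have /andP[lo hi] := A_bnd ustar; rewrite -(ler_pM2r U_gt0) (le_trans lo).
pose N : R := n%:R; have N_ge1 : 1 <= N by rewrite ler1n.
have epsl_l : epsl * l = 4 * N * (3 * N + 1) * (m * ul).
  by rewrite /epsl /N; field; rewrite gt_eqF.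
have m_gt0 : 0 < m by apply: lt_le_trans l_le_m.
have N_ul_le c : 0 <= c -> c * (N * ul * l) <= c * (N * ul * m).
  by move=> c_ge0; rewrite ler_wpM2l // ler_wpM2l // mulr_ge0 ?ltW //; lra.
have epsl_ge0 : 0 <= epsl.
  by rewrite -(pmulr_lge0 _ hlam_gt0) epsl_l !mulr_ge0 ?ltW //; lra.
have Nmu_ge0 : 0 <= N * ul * m by rewrite !mulr_ge0 ?ltW //; lra.
have NNmu_ge : N * ul * m <= N * (N * ul * m) by rewrite ler_peMl.
have epsl_l_lt : epsl * l < l by rewrite gtr_pMl.
(* From [N >= 1] and [m >= l], [4 * N * (3 * N + 1) * (m * ul)] is at least [16 * (N * ul) * l]. *)
have Nu_small : 16 * (N * ul) < 1.
  rewrite -(ltr_pM2r hlam_gt0) mul1r; have := N_ul_le 16 (ler0n _ _); lra.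
have u_small : 16 * ul < 1.
  by apply: le_lt_trans Nu_small; rewrite ler_pM2l // ler_peMl // ltW.
(* 8/7 is the largest factor for which [n g lambda_n <= lambda_1 / 7] follows from
   [epsl < 1]; at n = 1 both bounds are attained together. *)
pose g := 8 / 7 * (N + 1) * ul.
have g_ge0 : 0 <= g by rewrite /g !mulr_ge0 ?ltW //; lra.
(* Up to common factors this is [8 * N + 8 <= 12 * N + 4], that is, [1 <= N]. *)
have g_le : n%:R * g * m <= l / 7 by rewrite -/N /g; lra.
have prod_le : (1 + ul) ^+ n - 1 <= g.
  have := one_plus_exp_le n (ltW hul); rewrite -/N => pow_le.
  have Nu_gt0 : 0 < N * ul by rewrite mulr_gt0 //; lra.
  (* The factor [16 / 15] is [1 / (1 - N * ul)] at [N * ul = 1 / 16]. *)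
  have : (1 + ul) ^+ n <= 1 + 16 / 15 * (N * ul).
    rewrite -(ler_pM2r (_ : 0 < 1 - N * ul)); last by lra.
    by apply: le_trans pow_le _; nra.
  by rewrite /g; lra.
have quot_le : 1 <= (1 + g) * (1 - ul) ^+ 2.
  have g_ge : 16 / 7 * ul <= g.
    have : ul <= N * ul by rewrite ler_peMl // ltW.
    by rewrite /g; lra.
  (* The product exceeds 1 by [2 / 7 * ul - 25 / 7 * ul ^+ 2 + 16 / 7 * ul ^+ 3], nonnegative
     because [16 * ul < 1]. *)
  apply: (@le_trans _ _ ((1 + 16 / 7 * ul) * (1 - ul) ^+ 2)).
    have : 0 <= ul * (1 - 16 * ul) by rewrite mulr_ge0 ?subr_ge0 ?ltW.
    have : 0 <= ul ^+ 3 by rewrite exprn_ge0 // ltW.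
    by have := sqr_ge0 ul; lra.
  by rewrite ler_wpM2r ?sqr_ge0 // lerD2l.
have u_lt1 : ul < 1 by lra.
have L_res := computed_cholesky_residual (ltW hul) u_lt1 prod_le quot_le hLhat.
have L_brk (j : 'I_n) : Lhat j j = 0 ->
    (1 - g) * A j j <= (1 + g) * \sum_k Lhat j k ^+ 2.
  apply: (computed_cholesky_breakdown (ltW hul) u_lt1 prod_le hLhat).
  have := A_bnd (delta_mx j ord0); rewrite form_delta enorm_delta => /andP[lo _].
  by apply: le_trans lo; rewrite mulr1 ltW.
have L_trig := hLhat.1.
have pivots := cholesky_pivot_neq0 A_sym hlam_gt0 g_ge0 g_le A_bnd L_trig L_res L_brk.
have res_op w := cholesky_residual_op A_sym hlam_gt0 g_ge0 g_le A_bnd L_trig L_res L_brk w hn.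
have L_unit : Lhat \in unitmx.
  rewrite unitmxE unitfE det_trig; last exact/is_trig_mxP.
  by apply/prodf_neq0 => i _; apply: pivots.
(* The factor [7 / 3 * (n%:R * g * m)] equals [8 / 3 * N * (N + 1) * (m * ul)], below [epsl * l]. *)
have E_le (w : 'cV[R]_n) : enorm ((Lhat *m Lhat^T - A) *m w) <= epsl * l * enorm w.
  apply: le_trans (res_op w) _; rewrite ler_wpM2r ?enorm_ge0 // epsl_l -/N /g.
  by lra.
have e01 : 0 <= epsl < 1 by rewrite epsl_ge0.
have LLT_unit : Lhat *m Lhat^T \in unitmx by rewrite unitmx_mul unitmx_tr L_unit.
have M_le := preconditioned_error S_posdef.1 SS (posdefmx_unit S_posdef) LLT_unit
  hlam_gt0 e01 (fun v => proj1 (andP (A_bnd v))) E_le.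
have invB : invmx B = invmx (Lhat *m Lhat^T) by rewrite /B precondE.
have [cos_ge0 cos_le] : 0 <= cos phi /\ cos phi ^+ 2 <= 2 * epsl.
  apply: (cos_distortion_angle hsqrtA L_unit hlam_gt0 e01 hustar_neq0 hustar) => //.
  by rewrite precond_invE.
split=> //.
  by rewrite invB; apply: spectral_norm_le => //; rewrite divr_ge0 // subr_ge0 ltW.
by rewrite -[cos phi]ger0_norm // -sqrtr_sqr ler_wsqrtr.
Qed.
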